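(* Let $k\geq 1$ and let $G$ be a connected graph on at least $k+2$ vertices that does not contain $C_3$ or $K_{2,k+1}$ as an induced subgraph. Then $\operatorname{ppt}_k(G)=1$ if and only if $G$ has a minimum dominating set $S$ such that every vertex in $S$ is a $k$-strong support vertex. Furthermore, such an $S$ is the unique minimum dominating set of $G$.
   Context: All graphs are finite and simple. $C_3$ is the triangle and $K_{2,k+1}$ is the complete bipartite graph with parts of sizes $2$ and $k+1$. For a graph $G$ and $S\subseteq V(G)$, let $N(v)$ be the set of neighbors of $v$ and $N[S]=S\cup\bigcup_{s\in S}N(s)$. A dominating set is a set $S\subseteq V(G)$ with $N[S]=V(G)$; a minimum dominating set is a dominating set of minimum cardinality. A leaf is a vertex of degree $1$. A vertex $v$ is a $k$-strong support vertex if $v$ is adjacent to $k+1$ or more leaves. Define $S^{[0]}=S$, $S^{[1]}=N[S]$, and for $t\geq 1$, $S^{[t+1]}=S^{[t]}\cup\{w\in V(G) : \exists\, v\in S^{[t]},\ w\in N(v)\setminus S^{[t]} \text{ and } |N(v)\setminus S^{[t]}|\leq k\}$. The set $S$ is a $k$-power dominating set of $G$ if $S^{[\ell]}=V(G)$ for some $\ell$; a minimum $k$-power dominating set is one of minimum cardinality. For a $k$-power dominating set $S$, $\operatorname{ppt}_k(G,S)$ is the smallest $\ell\geq 0$ with $S^{[\ell]}=V(G)$. The $k$-power propagation time of $G$ is $\operatorname{ppt}_k(G)=\min\{\operatorname{ppt}_k(G,S) : S \text{ is a minimum } k\text{-power dominating set of } G\}$. *)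

(* Defs.v *)
From mathcomp Require Import all_boot.

Set Implicit Arguments.
Unset Strict Implicit.
Unset Printing Implicit Defensive.

(* A graph is an edge relation [e] on a [finType]; it is simple when [e] is
   symmetric and irreflexive. *)

Definition graph_connected (T : finType) (e : rel T) : Prop :=
  forall x y : T, connect e x y.

Definition contains_induced (U T : finType) (h : rel U) (e : rel T) : Prop :=
  exists2 f : U -> T, injective f & forall x y, e (f x) (f y) = h x y.

Definition C3 : rel 'I_3 := [rel x y | x != y].

Definition complete_bipartite (m n : nat) : rel ('I_m + 'I_n) :=
  fun x y => match x, y with
             | inl _, inr _ | inr _, inl _ => true
             | _, _ => false
             end.

Section Domination.

Variables (T : finType) (e : rel T).
Implicit Types (S D : {set T}) (v w : T).

Definition neighbors v : {set T} := [set w | e v w].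

Definition closed_neighborhood S : {set T} :=
  S :|: \bigcup_(s in S) neighbors s.

Definition dominating : pred {set T} :=
  fun S => closed_neighborhood S == [set: T].

Definition minimum_set (P : pred {set T}) (S : {set T}) : bool :=
  P S && [forall D : {set T}, P D ==> (#|S| <= #|D|)].

Definition minimum_dominating S : bool := minimum_set dominating S.

Definition leaf v : bool := #|neighbors v| == 1.

Definition strong_support (k : nat) v : bool :=
  k.+1 <= #|[set w in neighbors v | leaf w]|.

End Domination.

Section PowerDomination.

Variables (T : finType) (k : nat) (e : rel T).
Implicit Types (S X : {set T}) (l t : nat).

Local Notation N v := (neighbors e v).

Definition power_step X : {set T} :=
  X :|: [set w | [exists v in X, (w \in N v :\: X) && (#|N v :\: X| <= k)]].

(* S^[t]; the first step is plain domination, without the bound [k]. *)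
Fixpoint observed S t : {set T} :=
  match t with
  | 0 => S
  | t'.+1 => if t' is 0 then closed_neighborhood e S
             else power_step (observed S t')
  end.

Definition power_dominating S : Prop :=
  exists l, observed S l == [set: T].

Lemma observedSS S t : observed S t.+2 = power_step (observed S t.+1).
Proof. by []. Qed.

Lemma observed_sub S t : observed S t \subset observed S t.+1.
Proof. by case: t => [|t]; rewrite ?observedSS subsetUl. Qed.

Lemma observed_mono S t l : t <= l -> observed S t \subset observed S l.
Proof.
move=> /subnK <-; elim: (l - t) => [|m IH]; first by rewrite add0n.
by rewrite addSn; apply: subset_trans IH (observed_sub _ _).
Qed.

Lemma observed_stable S t m :
  observed S t.+2 = observed S t.+1 -> observed S (m + t).+1 = observed S t.+1.
Proof.
by rewrite observedSS => E; elim: m => // m IH; rewrite addSn observedSS IH.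
Qed.

Lemma observed_grows S t :
  observed S t.+2 = observed S t.+1 \/ t <= #|observed S t.+1|.
Proof.
elim: t => [|t [E|IH]]; first by right.
  by left; rewrite observedSS E -observedSS.
have [E|neq] := eqVneq (observed S t.+2) (observed S t.+1).
  by left; rewrite observedSS E -observedSS.
right; apply: leq_ltn_trans IH (proper_card _).
by rewrite properEneq eq_sym neq observed_sub.
Qed.

Lemma power_dominatingP S :
  reflect (power_dominating S) (observed S #|T|.+1 == [set: T]).
Proof.
apply: (iffP idP) => [E|[l /eqP E]]; first by exists #|T|.+1.
have [stab|full] := observed_grows S #|T|; last first.
  by rewrite eqEcard subsetT cardsT.
rewrite -(observed_stable l stab) -subTset -E.
by rewrite observed_mono // -addnS leq_addr.
Qed.

Definition power_dominating_dec S : decidable (power_dominating S) :=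
  decP (power_dominatingP S).

Definition minimum_power_dominating S : bool :=
  minimum_set (fun X => power_dominating_dec X) S.

(* ppt_k(G, S); the value 0 is junk when [S] is not power dominating. *)
Definition ppt_set S : nat :=
  if power_dominating_dec S is left exl then ex_minn exl else 0.

Lemma minimum_power_dominating_exists :
  exists S, minimum_power_dominating S.
Proof.
pose P : pred {set T} := fun X => power_dominating_dec X.
have PT : P [set: T] by apply/sumboolP; exists 0; rewrite /=.
have [S PS minS] := arg_minnP (fun X : {set T} => #|X|) PT.
by exists S; apply/andP; split=> //; apply/forallP=> D; apply/implyP/minS.
Qed.

Lemma ppt_exists :
  exists l, [exists S, minimum_power_dominating S && (ppt_set S == l)].
Proof.
have [S minS] := minimum_power_dominating_exists.
by exists (ppt_set S); apply/existsP; exists S; rewrite minS eqxx.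
Qed.

Definition ppt : nat := ex_minn ppt_exists.

End PowerDomination.

(* Main.v *)
Require Import Defs.
From mathcomp Require Import all_boot.

Set Implicit Arguments.
Unset Strict Implicit.
Unset Printing Implicit Defensive.

(** Every dominating set is [k]-power dominating, so [ppt k e = 1] says that
    some dominating set other than the whole vertex set has minimum cardinality
    among all [k]-power dominating sets.

    Suppose first that such a set [S] is given and that some [v] in [S] is not a
    [k]-strong support vertex. Then [S :\ v] is still [k]-power dominating,
    which contradicts minimality ([power_dominating_setD1]). Indeed only [v] and
    neighbors of [v] can be left unobserved after the domination step. A
    neighbor [w] of [v] that is not a leaf has a second neighbor [u]; since there
    are no triangles, [u] is not adjacent to [v], hence [u] is observed, and its
    unobserved neighbors are common neighbors of [u] and [v], of which there are
    at most [k] because there is no induced [K_{2,k+1}]. So [u] forces [w].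
    Next, [w] has no unobserved neighbor but [v], so it forces [v]; if there is
    no such [w] at all then the graph is a star, whose center is a [k]-strong
    support vertex. Finally [v] forces its unobserved neighbors, which are
    leaves, at most [k] in number.

    Conversely, the [k+1] leaves at a [k]-strong support vertex [v] can never be
    observed from outside, so every [k]-power dominating set [D] meets the set
    formed by [v] and its leaves ([power_dominating_meets_star]). Sending each
    leaf to its support vertex and fixing all other vertices therefore maps [D]
    onto a superset of [S], and [#|S| <= #|D|]. If moreover [D] is dominating
    with [#|D| = #|S|], this map is injective on [D]; were some [v] in [S]
    missing from [D], then [D] would contain all leaves at [v], at least two
    vertices with the same image. Hence [D = S]. *)

(** * Forbidden induced subgraphs *)

Section Forbidden.

Variables (T : finType) (e : rel T).
Hypotheses (e_sym : symmetric e) (e_irr : irreflexive e).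
Hypothesis noC3 : ~ contains_induced C3 e.

Lemma adj_neq x y : e x y -> x != y.
Proof. by apply: contraTneq => ->; rewrite e_irr. Qed.

Lemma triangle_free x y z : e x y -> e y z -> ~~ e x z.
Proof.
move=> exy eyz; apply/negP => exz; apply: noC3.
pose f (i : 'I_3) := tnth [tuple x; y; z] i.
have fE i j : e (f i) (f j) = C3 i j.
  by case: i j => [[|[|[|?]]] ?] // [[|[|[|?]]] ?] //;
    rewrite /f !(tnth_nth x) /= ?e_irr ?exy ?eyz ?exz // e_sym ?exy ?eyz ?exz.
exists f => // i j fij; apply/eqP; apply: contraFT (e_irr (f i)).
by move=> neq; rewrite {2}fij fE.
Qed.

(** The common neighbors of two vertices are pairwise non-adjacent, as there is
    no triangle; so [n] common neighbors of two non-adjacent vertices would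
    induce [K_{2,n}]. *)
Lemma card_common_neighbors n u v :
    ~ contains_induced (@complete_bipartite 2 n) e ->
    u != v -> ~~ e u v -> #|neighbors e u :&: neighbors e v| < n.
Proof.
move=> noK2 neq_uv nadj; rewrite ltnNge; apply/negP => le_n; apply: noK2.
pose A := neighbors e u :&: neighbors e v.
pose a (i : 'I_2) := if i == ord0 then u else v.
pose b (j : 'I_n) := enum_val (widen_ord le_n j : 'I_#|A|).
have eab i j : e (a i) (b j).
  have := enum_valP (widen_ord le_n j : 'I_#|A|).
  by rewrite !inE /a => /andP[? ?]; case: ifP.
have eaa i j : e (a i) (a j) = false.
  by rewrite /a; do 2![case: ifP => _]; rewrite ?e_irr ?(negbTE nadj) // e_sym;
    apply/negbTE.
have ebb i j : e (b i) (b j) = false.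
  by apply/negbTE/(triangle_free (y := a ord0)) => //; rewrite e_sym.
exists (fun x => match x with inl i => a i | inr j => b j end); last first.
  by move=> [i|i] [j|j]; rewrite /= ?eab ?eaa ?ebb // e_sym eab.
move=> [i|i] [j|j] /= eq_ij.
- congr inl; case: i j eq_ij => [[|[|?]] ?] // [[|[|?]] ?] //;
    rewrite /a /= => E; try exact: val_inj; by rewrite E eqxx in neq_uv.
- by have := eab i j; rewrite eq_ij e_irr.
- by have := eab j i; rewrite eq_ij e_irr.
- by congr inr; apply: val_inj; have /(congr1 val) := enum_val_inj eq_ij.
Qed.

End Forbidden.

(** * Domination and forcing *)

Section Forcing.

Variables (T : finType) (k : nat) (e : rel T).
Implicit Types (S X D : {set T}) (v w : T).

Local Notation N v := (neighbors e v).

Lemma closed_neighborhoodP S w :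
  reflect (w \in S \/ exists2 s, s \in S & e s w)
          (w \in closed_neighborhood e S).
Proof.
rewrite inE; apply: (iffP orP) => -[wS|]; try by left.
  by case/bigcupP => s sS; rewrite inE => esw; right; exists s.
by case=> s sS esw; right; apply/bigcupP; exists s; rewrite ?inE.
Qed.

Definition forcing_closed X :=
  forall v, v \in X -> #|N v :\: X| <= k -> N v \subset X.

Lemma forcing_closedP X : power_step k e X = X -> forcing_closed X.
Proof.
move=> stepX v vX le_k; apply/subsetP => w wN; rewrite -stepX !inE.
case: (boolP (w \in X)) => //= wX; apply/existsP; exists v.
by rewrite vX le_k !inE wX; rewrite inE in wN; rewrite wN.
Qed.

(** The observed sets cannot grow more than [#|T|] times, so the last of them is
    forcing closed. This frees the forcing arguments from counting steps. *)
Lemma power_dominating_closed S :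
    (forall X, closed_neighborhood e S \subset X -> forcing_closed X ->
       X = [set: T]) ->
  power_dominating k e S.
Proof.
move=> closedT; exists #|T|.+1; apply/eqP/closedT.
  exact: (@observed_mono _ k e S 1).
apply: forcing_closedP; rewrite -observedSS.
have [//|full] := observed_grows k e S #|T|.
have obsT : observed k e S #|T|.+1 = [set: T].
  by apply/eqP; rewrite eqEcard subsetT cardsT.
by rewrite observedSS obsT /power_step setTU.
Qed.

Lemma dominating_power_dominating S :
  dominating e S -> power_dominating k e S.
Proof. by move=> domS; exists 1. Qed.

Lemma minimum_power_dominatingP S :
  reflect (power_dominating k e S /\
           forall D, power_dominating k e D -> #|S| <= #|D|)
          (minimum_power_dominating k e S).
Proof.
apply: (iffP andP) => -[pS minS]; split.
- by move/sumboolP: pS.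
- move=> D pD; move/forallP/(_ D)/implyP: minS; apply.
  by apply/sumboolP.
- by apply/sumboolP.
- by apply/forallP => D; apply/implyP => /sumboolP; apply: minS.
Qed.

Lemma minimum_dominatingP S :
  reflect (dominating e S /\ forall D, dominating e D -> #|S| <= #|D|)
          (minimum_dominating e S).
Proof.
apply: (iffP andP) => -[pS minS]; split=> //.
  by move=> D; move/forallP/(_ D)/implyP: minS.
by apply/forallP => D; apply/implyP; apply: minS.
Qed.

Lemma ppt_setP S : power_dominating k e S ->
  observed k e S (ppt_set k e S) = [set: T] /\
  forall l, observed k e S l = [set: T] -> ppt_set k e S <= l.
Proof.
rewrite /ppt_set => pS; case: power_dominating_dec => // ex.
by case: ex_minnP => m /eqP obs minm; split=> // l /eqP; apply: minm.
Qed.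

Lemma ppt_eq1P :
  ppt k e = 1 <->
  exists S, [/\ dominating e S, S != [set: T]
              & forall D, power_dominating k e D -> #|S| <= #|D|].
Proof.
rewrite /ppt; case: ex_minnP => m /existsP[S /andP[minS /eqP mE]] minm.
have [pS cardS] := minimum_power_dominatingP _ minS.
have [obsS lowS] := ppt_setP pS.
split=> [m1 | [D [domD neqT cardD]]].
  rewrite mE m1 in obsS lowS; exists S; split=> //; first exact/eqP.
  by apply: contraTneq isT => ST; have := lowS 0 ST.
have pD := dominating_power_dominating domD.
have [_ /(_ 1 (eqP domD)) pptD] := ppt_setP pD.
have minD : minimum_power_dominating k e D.
  by apply/minimum_power_dominatingP.
have le_m : m <= ppt_set k e D.
  by apply: minm; apply/existsP; exists D; rewrite minD eqxx.
apply/eqP; rewrite eqn_leq (leq_trans le_m pptD) lt0n.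
apply: contraNneq neqT => m0; rewrite mE m0 /= in obsS.
by rewrite eqEcard subsetT -obsS cardS.
Qed.

End Forcing.

(** * Removing a vertex that is not a strong support vertex *)

Section Removal.

Variables (T : finType) (k : nat) (e : rel T).
Hypotheses (k_gt0 : 0 < k) (e_sym : symmetric e) (e_irr : irreflexive e).
Hypothesis e_conn : graph_connected e.
Hypothesis card_T : k + 2 <= #|T|.
Hypothesis noC3 : ~ contains_induced C3 e.
Hypothesis noK2 : ~ contains_induced (@complete_bipartite 2 k.+1) e.

Local Notation N v := (neighbors e v).

Lemma leaf_neighbor v w u : leaf e w -> e w v -> e w u -> u = v.
Proof.
case/cards1P => a Na ewv ewu.
have: v \in N w by rewrite inE.
have: u \in N w by rewrite inE.
by rewrite Na !inE => /eqP-> /eqP->.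
Qed.

Lemma nonleaf_neighbor v w : ~~ leaf e w -> e w v -> exists2 u, e w u & u != v.
Proof.
move=> nleaf ewv; have /subsetPn[u] : ~~ (N w \subset [set v]).
  apply: contra nleaf => sub; rewrite /leaf eqn_leq.
  rewrite (leq_trans (subset_leq_card sub)) ?cards1 //=.
  by apply/card_gt0P; exists v; rewrite inE.
by rewrite !inE => ewu neq; exists u.
Qed.

(** By connectedness the graph is then a star with center [v]. *)
Lemma star_strong_support v :
  (forall w, e v w -> leaf e w) -> strong_support e k v.
Proof.
move=> leaves; pose A := v |: N v.
have closedA : closed e [in A].
  apply: intro_closed; first by apply: sym_connect_sym.
  move=> x y exy; rewrite !inE => /predU1P[xv|evx].
    by rewrite -xv exy orbT.
  have exv : e x v by rewrite e_sym.
  by rewrite (leaf_neighbor (leaves _ evx) exv exy) eqxx.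
have AT : A = [set: T].
  apply/setP => x; rewrite [RHS]inE -(closed_connect closedA (e_conn v x)).
  by rewrite !inE eqxx.
have le_card : k.+1 <= #|N v|.
  have : #|A| = (#|N v|).+1 by rewrite cardsU1 inE e_irr.
  by rewrite AT cardsT => cT; move: card_T; rewrite cT addn2 ltnS.
rewrite /strong_support; apply: leq_trans le_card (subset_leq_card _).
by apply/subsetP => w; rewrite !inE => evw; rewrite evw leaves.
Qed.

(** If [v] has no neighbor in [S] then [v] itself is unobserved after the
    domination step; hence the argument for the neighbors of [v] that are not
    leaves must not rely on [v] being observed. *)
Lemma power_dominating_setD1 S v :
    dominating e S -> ~~ strong_support e k v ->
  power_dominating k e (S :\ v).
Proof.
move=> /eqP domS not_strong; apply: power_dominating_closed => X subX closX.
have unobs x : x \notin X -> x = v \/ e v x.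
  move=> xX; have : x \in closed_neighborhood e S by rewrite domS inE.
  have notS s : s \in S -> s != v -> (s == x) || e s x -> x \in X.
    move=> sS sv sx; apply: (subsetP subX); apply/closed_neighborhoodP.
    by case/orP: sx => [/eqP<-|esx]; [left|right; exists s => //];
      rewrite !inE ?sv.
  case/closed_neighborhoodP => [xS|[s sS esx]].
    left; apply/eqP; apply: contraNT xX => xv.
    by apply: (notS x); rewrite ?eqxx.
  have [sv|sv] := eqVneq s v; first by right; rewrite -sv.
  by case/negP: xX; apply: (notS s); rewrite ?esx ?orbT.
have nonleafX w : e v w -> ~~ leaf e w -> w \in X.
  move=> evw nleaf; have ewv : e w v by rewrite e_sym.
  have [u ewu uv] := nonleaf_neighbor nleaf ewv.
  have nadj : ~~ e v u := triangle_free e_sym e_irr noC3 evw ewu.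
  have uX : u \in X.
    apply/negP => /negP/unobs[uE|]; last exact/negP.
    by rewrite uE eqxx in uv.
  have uforces : #|N u :\: X| <= k.
    rewrite -ltnS; apply: leq_ltn_trans (subset_leq_card _)
      (card_common_neighbors e_sym e_irr noC3 noK2 uv _); last by rewrite e_sym.
    apply/subsetP => x; rewrite !inE => /andP[/unobs[->|evx] eux].
      by rewrite e_sym eux in nadj.
    by rewrite eux evx.
  by apply: (subsetP (closX u uX uforces)); rewrite inE e_sym.
have vX : v \in X.
  apply: contraNT not_strong => vX; apply: star_strong_support => w evw.
  apply: contraNT vX => nleaf; have wX := nonleafX w evw nleaf.
  have wforces : #|N w :\: X| <= k.
    apply: leq_trans k_gt0; rewrite -(cards1 v); apply: subset_leq_card.
    apply/subsetP => x; rewrite !inE => /andP[/unobs[->|evx] ewx] //.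
    by case/negP: (triangle_free e_sym e_irr noC3 evw ewx).
  by apply: (subsetP (closX w wX wforces)); rewrite inE e_sym.
have vforces : #|N v :\: X| <= k.
  rewrite -ltnS ltnNge; apply: contra not_strong => le_k.
  apply: leq_trans le_k (subset_leq_card _).
  apply/subsetP => x; rewrite !inE => /andP[xX evx]; rewrite evx.
  by apply: contraNT xX; apply: nonleafX.
apply/setP => x; rewrite inE; apply/negPn/negP => xX.
case: (unobs x xX) => [xv|evx]; first by rewrite xv vX in xX.
by case/negP: xX; apply: (subsetP (closX v vX vforces)); rewrite inE.
Qed.

End Removal.

(** * Sets of strong support vertices *)

Section StrongSupport.

Variables (T : finType) (k : nat) (e : rel T).
Hypotheses (k_gt0 : 0 < k) (e_sym : symmetric e) (e_irr : irreflexive e).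
Implicit Types (S D : {set T}) (v w : T).

Local Notation N v := (neighbors e v).

Lemma strong_support_nonleaf v : strong_support e k v -> ~~ leaf e v.
Proof.
rewrite /strong_support /leaf => strong; rewrite neq_ltn orbC.
suff -> : 1 < #|N v| by [].
apply: (leq_trans (leq_trans _ strong)) => //.
by apply: subset_leq_card; apply/subsetP => w; rewrite !inE => /andP[].
Qed.

(** From outside, the leaves at [v] can only be observed through [v], and [v]
    forces none of them as long as all [k+1] of them are unobserved. *)
Lemma power_dominating_meets_star v D :
    strong_support e k v -> power_dominating k e D ->
  exists2 x, x \in D & x = v \/ leaf e x /\ e x v.
Proof.
move=> strong [l /eqP obsT].
pose L := [set w in N v | leaf e w].
have [x /andP[xD xvL]|none] := pickP [pred x | (x \in D) && (x \in v |: L)].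
  exists x => //; move: xvL; rewrite !inE.
  by case/predU1P => [->|/andP[evx lx]]; [left|right; rewrite e_sym].
have Dv : v \notin D by have := none v; rewrite !inE eqxx andbT => ->.
have DL w : w \in L -> w \notin D.
  by move=> wL; have := none w; rewrite /= in_setU1 wL orbT andbT => ->.
have unobs t w : w \in L -> w \notin observed k e D t.
  have Lnb u x : u \in L -> e x u -> x = v.
    rewrite !inE => /andP[evu lu] exu.
    by apply: (leaf_neighbor lu); rewrite e_sym.
  elim: t w => [|[|t] IH] w wL; first exact: DL.
    apply/closed_neighborhoodP => -[|[s sD /(Lnb w s wL) sv]].
      exact/negP/DL.
    by rewrite -sv sD in Dv.
  rewrite observedSS !inE negb_or IH //; apply/existsP => -[x].
  rewrite !inE => /and3P[_ /andP[_ /(Lnb w x wL)->]].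
  rewrite leqNgt => /negP; apply.
  apply: leq_trans strong (subset_leq_card _); apply/subsetP => u uL.
  by rewrite inE IH //; move: uL; rewrite inE => /andP[].
have /card_gt0P[w wL] : 0 < #|L| by apply: leq_trans strong.
by have := unobs l w wL; rewrite obsT inE.
Qed.

(** Leaves go to their support vertex, other vertices are fixed. *)
Definition to_support x := if leaf e x then odflt x [pick y | e x y] else x.

Lemma to_support_leaf v x : leaf e x -> e x v -> to_support x = v.
Proof.
move=> lx exv; rewrite /to_support lx; case: pickP => [y exy|/(_ v)].
  exact: leaf_neighbor lx exv exy.
by rewrite exv.
Qed.

Lemma sub_to_support S D :
    (forall v, v \in S -> strong_support e k v) -> power_dominating k e D ->
  S \subset to_support @: D.
Proof.
move=> strong pD; apply/subsetP => v vS.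
have sv := strong v vS.
have [x xD [xv|[lx exv]]] := power_dominating_meets_star sv pD.
  apply/imsetP; exists x => //.
  by rewrite xv /to_support (negbTE (strong_support_nonleaf sv)).
by apply/imsetP; exists x => //; rewrite (to_support_leaf lx exv).
Qed.

Lemma leq_card_strong_support S D :
    (forall v, v \in S -> strong_support e k v) -> power_dominating k e D ->
  #|S| <= #|D|.
Proof.
move=> strong pD; apply: leq_trans (leq_imset_card to_support D).
exact/subset_leq_card/sub_to_support.
Qed.

Lemma dominating_strong_support_unique S D :
    (forall v, v \in S -> strong_support e k v) ->
    dominating e D -> #|D| <= #|S| -> D = S.
Proof.
move=> strong domD cardD; apply/esym/eqP; rewrite eqEcard cardD andbT.
have pD := dominating_power_dominating k domD.
have subS := subset_leq_card (sub_to_support strong pD).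
have /imset_injP inj : #|to_support @: D| == #|D|.
  by rewrite eqn_leq leq_imset_card (leq_trans cardD).
apply/subsetP => v vS; apply: contraT => vD.
have lD w : w \in [set w in N v | leaf e w] -> w \in D /\ to_support w = v.
  rewrite !inE => /andP[evw lw]; have ewv : e w v by rewrite e_sym.
  split; last exact: to_support_leaf.
  have : w \in closed_neighborhood e D by rewrite (eqP domD) inE.
  case/closed_neighborhoodP => // -[s sD esw].
  by rewrite -(leaf_neighbor lw ewv (_ : e w s)) ?sD // e_sym in vD *.
have /card_gt1P[a [b [aL bL]]] : 1 < #|[set w in N v | leaf e w]|.
  by apply: leq_trans (strong v vS); rewrite ltnS.
have [[aD av] [bD bv]] := (lD a aL, lD b bL).
by rewrite (inj a b) ?eqxx // av bv.
Qed.

End StrongSupport.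

Theorem theorem30 (k : nat) (T : finType) (e : rel T)
    (hk : 1 <= k)
    (e_sym : symmetric e) (e_irr : irreflexive e)
    (e_conn : graph_connected e)
    (card_T : k + 2 <= #|T|)
    (noC3 : ~ contains_induced C3 e)
    (noK2 : ~ contains_induced (@complete_bipartite 2 k.+1) e) :
  (ppt k e = 1 <->
   exists2 S : {set T}, minimum_dominating e S
     & forall v, v \in S -> strong_support e k v)
  /\
  (forall S : {set T}, minimum_dominating e S ->
     (forall v, v \in S -> strong_support e k v) ->
     forall D : {set T}, minimum_dominating e D -> D = S).
Proof.
split; last first.
  move=> S /minimum_dominatingP[domS _] strong D /minimum_dominatingP[domD minD].
  exact: (dominating_strong_support_unique hk e_sym strong domD (minD S domS)).
split=> [/ppt_eq1P[S [domS _ minS]] | [S minS strong]]; last apply/ppt_eq1P.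
  exists S.
    apply/minimum_dominatingP; split=> // D domD.
    exact/minS/dominating_power_dominating.
  move=> v vS; apply: contraT => not_strong.
  have := minS _ (power_dominating_setD1 hk e_sym e_irr e_conn card_T noC3 noK2
    domS not_strong).
  by rewrite (cardsD1 v S) vS ltnn.
have [domS _] := minimum_dominatingP _ _ minS.
exists S; split=> // [|D]; last exact: leq_card_strong_support.
(* A leaf at a strong support vertex is not itself one. *)
apply/eqP => ST; have allS x : strong_support e k x by apply: strong; rewrite ST.
have /card_gt0P[v _] : 0 < #|T| by apply: leq_trans card_T; rewrite addn2.
have /card_gt0P[w] : 0 < #|[set w in neighbors e v | leaf e w]|.
  exact: leq_trans (allS v).
by rewrite inE (negbTE (strong_support_nonleaf hk (allS w))) andbF.
Qed.
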